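(* Let $\mathbb X$ be a $\dagger$-isomix category, and consider the mixed unitary category given by the forgetful functor $\mathrm{Unitary}(\mathbb X)\to\mathbb X$ from the canonical unitary core. Then an object $U$ is a (canonical) compaction of an object $A\in\mathbb X$ (that is, $U$ carries a preunitary structure and there is a retraction $r:A\to U$) if and only if $U$ is the splitting of a coring $\dagger$-binary idempotent $\dagger(\mathsf u,\mathsf v):A\to A^\dagger$ (that is, there is such a $(\mathsf u,\mathsf v)$ for which the idempotent $\mathsf u\mathsf v:A\to A$ splits through $U$).
   Context: Composition is diagrammatic: $fg$ means $f$ followed by $g$. **LDCs.** A linearly distributive category (LDC) has two monoidal structures $(\otimes,\top)$, $(\oplus,\bot)$ with natural linear distributors $\partial^L:A\otimes(B\oplus C)\to(A\otimes B)\oplus C$, $\partial^R:(B\oplus C)\otimes A\to B\oplus(C\otimes A)$ satisfying the standard Cockett–Seely coherence conditions. A mix category is an LDC with a map $\mathsf{mix}:\bot\to\top$ such that the two composites $A\otimes B\cong A\otimes(\bot\oplus B)\xrightarrow{\partial^L}(A\otimes\bot)\oplus B\to(A\otimes\top)\oplus B\cong A\oplus B$ and $A\otimes B\cong(A\oplus\bot)\otimes B\xrightarrow{\partial^R}A\oplus(\bot\otimes B)\to A\oplus(\top\otimes B)\cong A\oplus B$ (using $\mathsf{mix}$ in the unlabelled step) agree; the common natural map is the mixor $\mathsf{mx}_{A,B}:A\otimes B\to A\oplus B$. It is an isomix category if $\mathsf{mix}$ is an isomorphism. The core of $\mathbb X$ is the full subcategory of objects $U$ such that $\mathsf{mx}_{U,X}$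 and $\mathsf{mx}_{X,U}$ are isomorphisms for all $X$. **Dagger.** A $\dagger$-LDC is an LDC with a functor $(\_)^\dagger:\mathbb X^{\mathrm{op}}\to\mathbb X$ and natural isomorphisms $\lambda_\otimes:A^\dagger\otimes B^\dagger\to(A\oplus B)^\dagger$, $\lambda_\oplus:A^\dagger\oplus B^\dagger\to(A\otimes B)^\dagger$, $\lambda_\top:\top\to\bot^\dagger$, $\lambda_\bot:\bot\to\top^\dagger$, $\iota:A\to A^{\dagger\dagger}$ satisfying the standard coherences: the $\lambda$'s are compatible with the associators, unitors and linear distributors (e.g. $\partial^L(\lambda_\otimes\oplus1)\lambda_\oplus=(1\otimes\lambda_\oplus)\lambda_\otimes(\partial^R)^\dagger:A^\dagger\otimes(B^\dagger\oplus C^\dagger)\to(A\oplus(B\otimes C))^\dagger$ up to the evident reading of $\partial^R:(A\oplus B)\otimes C\to A\oplus(B\otimes C)$); $\iota_{A\oplus B}\lambda_\otimes^\dagger=(\iota_A\oplus\iota_B)\lambda_\oplus$, $\iota_{A\otimes B}\lambda_\oplus^\dagger=(\iota_A\otimes\iota_B)\lambda_\otimes$; $\iota_\bot\lambda_\top^\dagger=\lambda_\bot$, $\iota_\top\lambda_\bot^\dagger=\lambda_\top$; $\iota_{A^\dagger}=(\iota_A^{-1})^\dagger$. A $\dagger$-isomix category is a $\dagger$-LDC which is an isomix category with $\mathsf{mix}\,\lambda_\top=\lambda_\bot\,\mathsf{mix}^\dagger$. **Unitary core.** A preunitary object is an object $U$ in the core with an isomorphism $\varphi:U\to U^\dagger$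 such that $\varphi(\varphi^{-1})^\dagger=\iota_U$. $\mathrm{Unitary}(\mathbb X)$ is the category of preunitary objects $(U,\varphi)$ with all maps of $\mathbb X$ between underlying objects; with its forgetful functor to $\mathbb X$ it forms a mixed unitary category. A compaction of $A$ to a preunitary object $(U,\varphi)$ in this mixed unitary category is a retraction $r:A\to U$, i.e. there is $s:U\to A$ with $sr=1_U$. **Binary idempotents.** A binary idempotent $(\mathsf u,\mathsf v):A\to B$ is a pair $\mathsf u:A\to B$, $\mathsf v:B\to A$ with $\mathsf u\mathsf v\mathsf u=\mathsf u$ and $\mathsf v\mathsf u\mathsf v=\mathsf v$. A $\dagger$-binary idempotent $\dagger(\mathsf u,\mathsf v):A\to A^\dagger$ is a binary idempotent with $B=A^\dagger$, $\mathsf u=\iota_A\mathsf u^\dagger$ and $\mathsf v^\dagger=\mathsf v\iota_A$. An idempotent $e:A\to A$ is coring if there are transformations $\kappa^L_X:X\oplus A\to X\otimes A$ and $\kappa^R_X:A\oplus X\to A\otimes X$, natural in $X$, such that $(1\otimes e)\,\mathsf{mx}\,\kappa^L_X=1\otimes e$, $(1\oplus e)\,\kappa^L_X\,\mathsf{mx}=1\oplus e$, $(e\otimes1)\,\mathsf{mx}\,\kappa^R_X=e\otimes1$, $(e\oplus1)\,\kappa^R_X\,\mathsf{mx}=e\oplus1$. A binary idempotent is coring if $\mathsf u\mathsf v$ or $\mathsf v\mathsf u$ is a coring idempotent. An idempotent $e:A\to A$ splits through $U$ if $e=rs$ with $r:A\to U$, $s:U\to A$ and $sr=1_U$. *)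

(* Defs.v *)
Set Implicit Arguments.
Unset Strict Implicit.
Unset Printing Implicit Defensive.

(** * Categories and functors *)

Record Category := {
  ob :> Type;
  hom : ob -> ob -> Type;
  idm : forall A, hom A A;
  comp : forall A B C, hom A B -> hom B C -> hom A C;
  comp_id_l : forall A B (f : hom A B), comp (idm A) f = f;
  comp_id_r : forall A B (f : hom A B), comp f (idm B) = f;
  comp_assoc : forall A B C D (f : hom A B) (g : hom B C) (h : hom C D),
    comp (comp f g) h = comp f (comp g h)
}.

Declare Scope cat_scope.
Open Scope cat_scope.

Arguments idm {c} A.
Arguments comp {c A B C} f g.

Reserved Notation "A ~> B" (at level 70, no associativity).
Reserved Notation "f ;; g" (at level 60, right associativity).
Reserved Notation "A ⊗ B" (at level 45, left associativity).
Reserved Notation "A ⊕ B" (at level 45, left associativity).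
Reserved Notation "f ⊗₁ g" (at level 45, left associativity).
Reserved Notation "f ⊕₁ g" (at level 45, left associativity).

Notation "A ~> B" := (hom A B) : cat_scope.
(** Composition is diagrammatic: [f ;; g] is [f] followed by [g]. *)
Notation "f ;; g" := (comp f g) : cat_scope.

Definition is_iso (C : Category) (A B : C) (f : A ~> B) : Prop :=
  exists g : B ~> A, f ;; g = idm A /\ g ;; f = idm B.

Record Iso (C : Category) (A B : C) := {
  mor :> A ~> B;
  inv : B ~> A;
  iso_mor_inv : mor ;; inv = idm A;
  iso_inv_mor : inv ;; mor = idm B
}.

Definition is_retraction (C : Category) (A U : C) (r : A ~> U) : Prop :=
  exists s : U ~> A, s ;; r = idm U.

Definition op (C : Category) : Category := {|
  ob := ob C;
  hom := fun A B => hom B A;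
  idm := fun A => idm A;
  comp := fun A B D f g => g ;; f;
  comp_id_l := fun A B f => comp_id_r f;
  comp_id_r := fun A B f => comp_id_l f;
  comp_assoc := fun A B D E f g h => eq_sym (comp_assoc h g f)
|}.

Record Functor (C D : Category) := {
  fob :> C -> D;
  fmap : forall A B : C, (A ~> B) -> (fob A ~> fob B);
  fmap_id : forall A : C, fmap (idm A) = idm (fob A);
  fmap_comp : forall (A B E : C) (f : A ~> B) (g : B ~> E),
    fmap (f ;; g) = fmap f ;; fmap g
}.

Definition contramap (C D : Category) (F : Functor (op C) D) (A B : C)
  (f : A ~> B) : F B ~> F A := @fmap (op C) D F B A f.

(** * Monoidal structures *)

Record Monoidal (C : Category) := {
  prd : C -> C -> C;
  prdm : forall A A' B B' : C, (A ~> A') -> (B ~> B') -> (prd A B ~> prd A' B');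
  unt : C;
  prdm_id : forall A B : C, prdm (idm A) (idm B) = idm (prd A B);
  prdm_comp : forall (A1 A2 A3 B1 B2 B3 : C)
    (f : A1 ~> A2) (f' : A2 ~> A3) (g : B1 ~> B2) (g' : B2 ~> B3),
    prdm (f ;; f') (g ;; g') = prdm f g ;; prdm f' g';

  assoc : forall A B D : C, Iso (prd (prd A B) D) (prd A (prd B D));
  unitl : forall A : C, Iso (prd unt A) A;
  unitr : forall A : C, Iso (prd A unt) A;

  assoc_nat : forall (A A' B B' D D' : C)
    (f : A ~> A') (g : B ~> B') (h : D ~> D'),
    prdm (prdm f g) h ;; assoc A' B' D' = assoc A B D ;; prdm f (prdm g h);
  unitl_nat : forall (A A' : C) (f : A ~> A'),
    prdm (idm unt) f ;; unitl A' = unitl A ;; f;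
  unitr_nat : forall (A A' : C) (f : A ~> A'),
    prdm f (idm unt) ;; unitr A' = unitr A ;; f;

  triangle : forall A B : C,
    assoc A unt B ;; prdm (idm A) (unitl B) = prdm (unitr A) (idm B);
  pentagon : forall A B D E : C,
    assoc (prd A B) D E ;; assoc A B (prd D E)
    = prdm (assoc A B D) (idm E) ;; assoc A (prd B D) E
      ;; prdm (idm A) (assoc B D E)
}.

(** * Linearly distributive categories *)

(** The coherence conditions are those of Cockett and Seely for the planar
    (not necessarily symmetric) case. *)
Record LDC := {
  ldc_cat :> Category;
  tensor : Monoidal ldc_cat;
  par : Monoidal ldc_cat;

  distl : forall A B C : ldc_cat,
    prd tensor A (prd par B C) ~> prd par (prd tensor A B) C
    where "A ⊗ B" := (prd tensor A B) and "A ⊕ B" := (prd par A B)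
    and "f ⊗₁ g" := (prdm tensor f g) and "f ⊕₁ g" := (prdm par f g);
  distr : forall A B C : ldc_cat, (B ⊕ C) ⊗ A ~> B ⊕ (C ⊗ A);

  distl_nat : forall (A A' B B' C C' : ldc_cat)
    (f : A ~> A') (g : B ~> B') (h : C ~> C'),
    f ⊗₁ (g ⊕₁ h) ;; distl A' B' C' = distl A B C ;; (f ⊗₁ g) ⊕₁ h;
  distr_nat : forall (A A' B B' C C' : ldc_cat)
    (f : A ~> A') (g : B ~> B') (h : C ~> C'),
    (g ⊕₁ h) ⊗₁ f ;; distr A' B' C' = distr A B C ;; g ⊕₁ (h ⊗₁ f);

  distl_unitl : forall A B : ldc_cat,
    distl (unt tensor) A B ;; unitl tensor A ⊕₁ idm B = unitl tensor (A ⊕ B);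
  distl_unitr : forall A B : ldc_cat,
    distl A B (unt par) ;; unitr par (A ⊗ B) = idm A ⊗₁ unitr par B;
  distr_unitr : forall A B : ldc_cat,
    distr (unt tensor) A B ;; idm A ⊕₁ unitr tensor B = unitr tensor (A ⊕ B);
  distr_unitl : forall A B : ldc_cat,
    distr B (unt par) A ;; unitl par (A ⊗ B) = unitl par A ⊗₁ idm B;

  distl_assoc_tensor : forall A B C D : ldc_cat,
    assoc tensor A B (C ⊕ D) ;; idm A ⊗₁ distl B C D ;; distl A (B ⊗ C) D
    = distl (A ⊗ B) C D ;; assoc tensor A B C ⊕₁ idm D;
  distl_assoc_par : forall A B C D : ldc_cat,
    idm A ⊗₁ assoc par B C D ;; distl A B (C ⊕ D)
    = distl A (B ⊕ C) D ;; distl A B C ⊕₁ idm D ;; assoc par (A ⊗ B) C D;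
  distr_assoc_tensor : forall A B C D : ldc_cat,
    assoc tensor (A ⊕ B) C D ;; distr (C ⊗ D) A B
    = distr C A B ⊗₁ idm D ;; distr D A (B ⊗ C)
      ;; idm A ⊕₁ assoc tensor B C D;
  distr_assoc_par : forall A B C D : ldc_cat,
    assoc par A B C ⊗₁ idm D ;; distr D A (B ⊕ C) ;; idm A ⊕₁ distr D B C
    = distr D (A ⊕ B) C ;; assoc par A B (C ⊗ D);

  distl_distr_par : forall A B C D : ldc_cat,
    distl (A ⊕ B) C D ;; distr C A B ⊕₁ idm D ;; assoc par A (B ⊗ C) D
    = distr (C ⊕ D) A B ;; idm A ⊕₁ distl B C D;
  distl_distr_tensor : forall A B C D : ldc_cat,
    assoc tensor A (B ⊕ C) D ;; idm A ⊗₁ distr D B C ;; distl A B (C ⊗ D)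
    = distl A B C ⊗₁ idm D ;; distr D (A ⊗ B) C
}.

Notation "A ⊗ B" := (prd (tensor _) A B) : cat_scope.
Notation "A ⊕ B" := (prd (par _) A B) : cat_scope.
Notation "f ⊗₁ g" := (prdm (tensor _) f g) : cat_scope.
Notation "f ⊕₁ g" := (prdm (par _) f g) : cat_scope.
Notation "⊤" := (unt (tensor _)) : cat_scope.
Notation "⊥" := (unt (par _)) : cat_scope.

(** * Mix and isomix categories *)

Definition mixor_left (X : LDC) (m : (⊥ : X) ~> ⊤) (A B : X)
  : A ⊗ B ~> A ⊕ B :=
  idm A ⊗₁ inv (unitl (par X) B) ;; distl A ⊥ B
  ;; (idm A ⊗₁ m) ⊕₁ idm B ;; unitr (tensor X) A ⊕₁ idm B.

Definition mixor_right (X : LDC) (m : (⊥ : X) ~> ⊤) (A B : X)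
  : A ⊗ B ~> A ⊕ B :=
  inv (unitr (par X) A) ⊗₁ idm B ;; distr B A ⊥
  ;; idm A ⊕₁ (m ⊗₁ idm B) ;; idm A ⊕₁ unitl (tensor X) B.

Record MixCategory := {
  mix_ldc :> LDC;
  mix : (⊥ : mix_ldc) ~> ⊤;
  mix_coh : forall A B : mix_ldc, mixor_left mix A B = mixor_right mix A B
}.

Definition mx (X : MixCategory) (A B : X) : A ⊗ B ~> A ⊕ B :=
  mixor_left (mix X) A B.

Record IsomixCategory := {
  isomix_mix :> MixCategory;
  mix_iso : is_iso (mix isomix_mix)
}.

Definition in_core (X : MixCategory) (U : X) : Prop :=
  forall A : X, is_iso (mx U A) /\ is_iso (mx A U).

(** * Daggers *)

Record Dagger (X : LDC) := {
  dagF : Functor (op X) X;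

  lam_tensor : forall A B : X, Iso (dagF A ⊗ dagF B) (dagF (A ⊕ B));
  lam_par : forall A B : X, Iso (dagF A ⊕ dagF B) (dagF (A ⊗ B));
  lam_top : Iso ⊤ (dagF ⊥);
  lam_bot : Iso ⊥ (dagF ⊤);
  iota : forall A : X, Iso A (dagF (dagF A));

  lam_tensor_nat : forall (A A' B B' : X) (f : A ~> A') (g : B ~> B'),
    contramap dagF f ⊗₁ contramap dagF g ;; lam_tensor A B
    = lam_tensor A' B' ;; contramap dagF (f ⊕₁ g);
  lam_par_nat : forall (A A' B B' : X) (f : A ~> A') (g : B ~> B'),
    contramap dagF f ⊕₁ contramap dagF g ;; lam_par A B
    = lam_par A' B' ;; contramap dagF (f ⊗₁ g);
  iota_nat : forall (A A' : X) (f : A ~> A'),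
    f ;; iota A' = iota A ;; contramap dagF (contramap dagF f);

  lam_tensor_assoc : forall A B C : X,
    lam_tensor A B ⊗₁ idm (dagF C) ;; lam_tensor (A ⊕ B) C
    = assoc (tensor X) (dagF A) (dagF B) (dagF C)
      ;; idm (dagF A) ⊗₁ lam_tensor B C ;; lam_tensor A (B ⊕ C)
      ;; contramap dagF (assoc (par X) A B C);
  lam_par_assoc : forall A B C : X,
    lam_par A B ⊕₁ idm (dagF C) ;; lam_par (A ⊗ B) C
    = assoc (par X) (dagF A) (dagF B) (dagF C)
      ;; idm (dagF A) ⊕₁ lam_par B C ;; lam_par A (B ⊗ C)
      ;; contramap dagF (assoc (tensor X) A B C);

  lam_tensor_unitl : forall A : X,
    lam_top ⊗₁ idm (dagF A) ;; lam_tensor ⊥ A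
    = unitl (tensor X) (dagF A) ;; contramap dagF (unitl (par X) A);
  lam_tensor_unitr : forall A : X,
    idm (dagF A) ⊗₁ lam_top ;; lam_tensor A ⊥
    = unitr (tensor X) (dagF A) ;; contramap dagF (unitr (par X) A);
  lam_par_unitl : forall A : X,
    lam_bot ⊕₁ idm (dagF A) ;; lam_par ⊤ A
    = unitl (par X) (dagF A) ;; contramap dagF (unitl (tensor X) A);
  lam_par_unitr : forall A : X,
    idm (dagF A) ⊕₁ lam_bot ;; lam_par A ⊤
    = unitr (par X) (dagF A) ;; contramap dagF (unitr (tensor X) A);

  lam_distl : forall A B C : X,
    distl (dagF A) (dagF B) (dagF C)
      ;; lam_tensor A B ⊕₁ idm (dagF C) ;; lam_par (A ⊕ B) C
    = idm (dagF A) ⊗₁ lam_par B C ;; lam_tensor A (B ⊗ C)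
      ;; contramap dagF (distr C A B);
  lam_distr : forall A B C : X,
    distr (dagF C) (dagF A) (dagF B)
      ;; idm (dagF A) ⊕₁ lam_tensor B C ;; lam_par A (B ⊕ C)
    = lam_par A B ⊗₁ idm (dagF C) ;; lam_tensor (A ⊗ B) C
      ;; contramap dagF (distl A B C);

  iota_par : forall A B : X,
    iota (A ⊕ B) ;; contramap dagF (lam_tensor A B)
    = iota A ⊕₁ iota B ;; lam_par (dagF A) (dagF B);
  iota_tensor : forall A B : X,
    iota (A ⊗ B) ;; contramap dagF (lam_par A B)
    = iota A ⊗₁ iota B ;; lam_tensor (dagF A) (dagF B);
  iota_bot : iota ⊥ ;; contramap dagF lam_top = lam_bot;
  iota_top : iota ⊤ ;; contramap dagF lam_bot = lam_top;
  iota_dag : forall A : X, mor (iota (dagF A)) = contramap dagF (inv (iota A))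
}.

Record DaggerIsomix := {
  di_isomix :> IsomixCategory;
  dagger : Dagger di_isomix;
  dagger_mix : mix di_isomix ;; lam_top dagger
               = lam_bot dagger ;; contramap (dagF dagger) (mix di_isomix)
}.

Notation "A '†'" := (dagF (dagger _) A) (at level 1, format "A '†'")
  : cat_scope.
Notation "f '†₁'" := (contramap (dagF (dagger _)) f)
  (at level 1, format "f '†₁'") : cat_scope.
Notation ι := (iota (dagger _)).

(** * The canonical unitary core *)

Record Preunitary (X : DaggerIsomix) (U : X) := {
  pu_core : in_core U;
  pu_iso : Iso U U†;
  pu_iota : pu_iso ;; (inv pu_iso)†₁ = ι U
}.

Record PreunitaryObject (X : DaggerIsomix) := {
  pu_ob : X;
  pu_str : Preunitary pu_ob
}.

Definition Unitary (X : DaggerIsomix) : Category := {|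
  ob := PreunitaryObject X;
  hom := fun U V => pu_ob U ~> pu_ob V;
  idm := fun U => idm (pu_ob U);
  comp := fun U V W f g => f ;; g;
  comp_id_l := fun U V f => comp_id_l f;
  comp_id_r := fun U V f => comp_id_r f;
  comp_assoc := fun U V W Z f g h => comp_assoc f g h
|}.

Definition forgetful (X : DaggerIsomix) : Functor (Unitary X) X :=
  @Build_Functor (Unitary X) X (fun U => pu_ob U) (fun U V f => f)
    (fun U => eq_refl) (fun U V W f g => eq_refl).

Definition is_compaction (X : DaggerIsomix) (A : X) (U : Unitary X)
  (r : A ~> forgetful X U) : Prop := is_retraction r.

Definition canonical_compaction (X : DaggerIsomix) (A U : X) : Prop :=
  exists (phi : Preunitary U)
    (r : A ~> forgetful X {| pu_ob := U; pu_str := phi |}),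
    is_compaction r.

(** * Binary idempotents *)

Definition is_idempotent (C : Category) (A : C) (e : A ~> A) : Prop :=
  e ;; e = e.

Definition binary_idempotent (C : Category) (A B : C)
  (u : A ~> B) (v : B ~> A) : Prop :=
  u ;; v ;; u = u /\ v ;; u ;; v = v.

Definition dagger_binary_idempotent (X : DaggerIsomix) (A : X)
  (u : A ~> A†) (v : A† ~> A) : Prop :=
  binary_idempotent u v /\ u = ι A ;; u†₁ /\ v†₁ = v ;; ι A.

Definition coring_idempotent (X : MixCategory) (A : X) (e : A ~> A) : Prop :=
  is_idempotent e /\
  exists (kL : forall Z : X, Z ⊕ A ~> Z ⊗ A) (kR : forall Z : X, A ⊕ Z ~> A ⊗ Z),
    (forall (Z Z' : X) (f : Z ~> Z'),
        f ⊕₁ idm A ;; kL Z' = kL Z ;; f ⊗₁ idm A) /\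
    (forall (Z Z' : X) (f : Z ~> Z'),
        idm A ⊕₁ f ;; kR Z' = kR Z ;; idm A ⊗₁ f) /\
    (forall Z : X, idm Z ⊗₁ e ;; mx Z A ;; kL Z = idm Z ⊗₁ e) /\
    (forall Z : X, idm Z ⊕₁ e ;; kL Z ;; mx Z A = idm Z ⊕₁ e) /\
    (forall Z : X, e ⊗₁ idm Z ;; mx A Z ;; kR Z = e ⊗₁ idm Z) /\
    (forall Z : X, e ⊕₁ idm Z ;; kR Z ;; mx A Z = e ⊕₁ idm Z).

Definition coring_binary_idempotent (X : MixCategory) (A B : X)
  (u : A ~> B) (v : B ~> A) : Prop :=
  binary_idempotent u v /\
  (coring_idempotent (u ;; v) \/ coring_idempotent (v ;; u)).

Definition splits_through (C : Category) (A : C) (e : A ~> A) (U : C) : Prop :=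
  exists (r : A ~> U) (s : U ~> A), e = r ;; s /\ s ;; r = idm U.

(* Main.v *)
From Stdlib Require Import IndefiniteDescription.
Require Import Defs.

Set Implicit Arguments.
Unset Strict Implicit.
Unset Printing Implicit Defensive.

(** Everything rests on transporting structure along a splitting [e = r ;; s],
    [s ;; r = idm U].

    A dagger binary idempotent [(u, v)] on [A] makes [A] preunitary up to [e]:
    [u] is an isomorphism [A ~> A†] with inverse [v], except that the composites
    are [e = u ;; v] and [e†] instead of identities, and the two dagger
    conditions yield the preunitarity equation for it.  Splitting [e] turns
    identities up to [e] into identities on [U], so [s ;; u ;; s†] is a
    preunitary structure on [U], with inverse [r† ;; v ;; r].  Conversely, a
    preunitary [phi] on [U] pulls back along [r] to [u = r ;; phi ;; r†],
    [v = s† ;; phi^-1 ;; s], for which [u ;; v = r ;; s].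

    The coring condition says in the same way that the mixor is invertible at
    [A] up to [e], on either side and naturally in the other argument; it
    therefore amounts to the mixor being invertible at [U], that is, to [U]
    being in the core ([coring_splitting_in_core], [core_splitting_coring]).
    Both instances of this principle, for the two arguments of the mixor, are
    cases of one statement on a natural transformation and a splitting in its
    source category ([component_iso_of_split], [split_component_inverse]).

    The coring hypothesis may bear on [v ;; u] rather than [u ;; v], but in any
    binary idempotent these two split through the same objects
    ([splitting_swap]). *)

(** * Whiskering functors and naturality of the mixor *)

Lemma comp_cancel_l (C : Category) (A B D : C) (f : A ~> B) (g : B ~> A)
  (h : A ~> D) : f ;; g = idm A -> f ;; g ;; h = h.
Proof. intro E. now rewrite <- comp_assoc, E, comp_id_l. Qed.

Definition prd_left (C : Category) (M : Monoidal C) (Z : C) : Functor C C.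
Proof.
  refine {| fob := fun A => prd M Z A;
            fmap := fun A B f => prdm M (idm Z) f |}.
  - intro A. apply prdm_id.
  - intros A B E f g. now rewrite <- prdm_comp, comp_id_l.
Defined.

Definition prd_right (C : Category) (M : Monoidal C) (Z : C) : Functor C C.
Proof.
  refine {| fob := fun A => prd M A Z;
            fmap := fun A B f => prdm M f (idm Z) |}.
  - intro A. apply prdm_id.
  - intros A B E f g. now rewrite <- prdm_comp, comp_id_l.
Defined.

Lemma prdm_interchange (C : Category) (M : Monoidal C) (A A' B B' : C)
  (f : A ~> A') (g : B ~> B') :
  prdm M f (idm B) ;; prdm M (idm A') g = prdm M (idm A) g ;; prdm M f (idm B').
Proof. now rewrite <- !prdm_comp, !comp_id_l, !comp_id_r. Qed.

Lemma iso_inv_nat (C : Category) (A A' B B' : C) (i : Iso A B) (j : Iso A' B')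
  (f : A ~> A') (g : B ~> B') :
  f ;; j = i ;; g -> g ;; inv j = inv i ;; f.
Proof.
  intro E.
  rewrite <- (comp_id_r f), <- (iso_mor_inv j), <- (comp_assoc f), E.
  rewrite (comp_assoc i), <- (comp_assoc (inv i)), iso_inv_mor.
  now rewrite comp_id_l.
Qed.

Lemma mx_nat (X : MixCategory) (A A' B B' : X) (f : A ~> A') (g : B ~> B') :
  f ⊗₁ g ;; mx A' B' = mx A B ;; f ⊕₁ g.
Proof.
  unfold mx, mixor_left. rewrite !comp_assoc, <- !prdm_comp.
  rewrite <- comp_assoc, <- prdm_comp, comp_id_r.
  rewrite (iso_inv_nat (unitl_nat (par X) g)).
  rewrite <- (comp_id_l f) at 1. rewrite prdm_comp, comp_assoc.
  rewrite <- (comp_assoc (f ⊗₁ _)), distl_nat.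
  rewrite !comp_assoc, <- !prdm_comp, !comp_id_l, !comp_id_r.
  rewrite <- unitr_nat, <- !comp_assoc, <- !prdm_comp.
  now rewrite !comp_id_l, !comp_id_r.
Qed.

(** * Invertibility up to a split idempotent *)

Section SplitComponents.

Variables (C D : Category) (F G : Functor C D).
Variable m : forall A : C, F A ~> G A.
Hypothesis m_nat : forall (A B : C) (f : A ~> B),
  fmap F f ;; m B = m A ;; fmap G f.

Variables (A U : C) (r : A ~> U) (s : U ~> A).
Hypothesis sr : s ;; r = idm U.

(** Naturality moves [m U] to [m A] across [s] or [r], and [s ;; (r ;; s) = s]
    supplies the idempotent which makes [k] cancel [m A]. *)
Lemma component_iso_of_split (k : G A ~> F A) :
  fmap F (r ;; s) ;; m A ;; k = fmap F (r ;; s) ->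
  fmap G (r ;; s) ;; k ;; m A = fmap G (r ;; s) ->
  is_iso (m U).
Proof.
  intros HF HG.
  assert (ss : s = s ;; r ;; s) by (now rewrite (comp_cancel_l _ sr)).
  exists (fmap G s ;; k ;; fmap F r). split.
  - rewrite <- comp_assoc, <- m_nat.
    rewrite ss at 1. rewrite fmap_comp, !comp_assoc.
    rewrite <- (comp_assoc (m A)), <- (comp_assoc (fmap F (r ;; s))), HF.
    now rewrite <- !fmap_comp, !comp_assoc, sr, comp_id_r, sr, fmap_id.
  - rewrite !comp_assoc, m_nat.
    rewrite ss at 1. rewrite fmap_comp, !comp_assoc.
    rewrite <- (comp_assoc k), <- (comp_assoc (fmap G (r ;; s))), HG.
    now rewrite <- !fmap_comp, !comp_assoc, sr, comp_id_r, sr, fmap_id.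
Qed.

Lemma split_component_inverse (n : G U ~> F U) :
  m U ;; n = idm (F U) -> n ;; m U = idm (G U) ->
  fmap F (r ;; s) ;; m A ;; (fmap G r ;; n ;; fmap F s) = fmap F (r ;; s) /\
  fmap G (r ;; s) ;; (fmap G r ;; n ;; fmap F s) ;; m A = fmap G (r ;; s).
Proof.
  intros Hmn Hnm.
  assert (rr : (r ;; s) ;; r = r) by (now rewrite comp_assoc, sr, comp_id_r).
  split.
  - rewrite <- (comp_assoc (m A)), <- m_nat, <- !comp_assoc, <- fmap_comp, rr.
    rewrite (comp_assoc _ (m U)), Hmn, comp_id_r.
    now rewrite fmap_comp.
  - rewrite <- !comp_assoc, <- fmap_comp, rr, !comp_assoc, m_nat.
    now rewrite <- (comp_assoc n), Hnm, comp_id_l, fmap_comp.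
Qed.

End SplitComponents.

(** * Coring idempotents and the core *)

Lemma coring_splitting_in_core (X : MixCategory) (A U : X)
  (r : A ~> U) (s : U ~> A) :
  s ;; r = idm U -> coring_idempotent (r ;; s) -> in_core U.
Proof.
  intros sr (_ & kL & kR & _ & _ & HL1 & HL2 & HR1 & HR2) Z. split.
  - apply (@component_iso_of_split X X (prd_right (tensor X) Z)
             (prd_right (par X) Z) (fun B => mx B Z)
             (fun B B' f => mx_nat f (idm Z)) A U r s sr (kR Z)).
    + apply HR1.
    + apply HR2.
  - apply (@component_iso_of_split X X (prd_left (tensor X) Z)
             (prd_left (par X) Z) (fun B => mx Z B)
             (fun B B' f => mx_nat (idm Z) f) A U r s sr (kL Z)).
    + apply HL1.
    + apply HL2.
Qed.

(** The witnesses are [1 ⊕ r ;; mx^-1 ;; 1 ⊗ s] and its mirror image.  They are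
    families of maps, so inverses of the mixor, which the core only asserts to
    exist, are picked by a choice principle; as inverses are unique, the choice
    does not affect naturality. *)
Lemma core_splitting_coring (X : MixCategory) (A U : X)
  (r : A ~> U) (s : U ~> A) :
  s ;; r = idm U -> in_core U -> coring_idempotent (r ;; s).
Proof.
  intros sr core. split.
  { unfold is_idempotent. now rewrite comp_assoc, (comp_cancel_l _ sr). }
  set (cR := fun Z => constructive_indefinite_description _ (proj1 (core Z))).
  set (cL := fun Z => constructive_indefinite_description _ (proj2 (core Z))).
  set (nR := fun Z => proj1_sig (cR Z)). set (nL := fun Z => proj1_sig (cL Z)).
  pose (iR := fun Z => {| mor := mx U Z; inv := nR Z;
    iso_mor_inv := proj1 (proj2_sig (cR Z));
    iso_inv_mor := proj2 (proj2_sig (cR Z)) |}).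
  pose (iL := fun Z => {| mor := mx Z U; inv := nL Z;
    iso_mor_inv := proj1 (proj2_sig (cL Z));
    iso_inv_mor := proj2 (proj2_sig (cL Z)) |}).
  assert (HL := fun Z => @split_component_inverse X X (prd_left (tensor X) Z)
             (prd_left (par X) Z) (fun B => mx Z B)
             (fun B B' f => mx_nat (idm Z) f) A U r s sr (nL Z)
             (iso_mor_inv (iL Z)) (iso_inv_mor (iL Z))).
  assert (HR := fun Z => @split_component_inverse X X (prd_right (tensor X) Z)
             (prd_right (par X) Z) (fun B => mx B Z)
             (fun B B' f => mx_nat f (idm Z)) A U r s sr (nR Z)
             (iso_mor_inv (iR Z)) (iso_inv_mor (iR Z))).
  exists (fun Z => idm Z ⊕₁ r ;; nL Z ;; idm Z ⊗₁ s).
  exists (fun Z => r ⊕₁ idm Z ;; nR Z ;; s ⊗₁ idm Z).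
  repeat split.
  - intros Z Z' f.
    assert (N : f ⊕₁ idm U ;; nL Z' = nL Z ;; f ⊗₁ idm U)
      by exact (iso_inv_nat (i := iL Z) (j := iL Z') (mx_nat f (idm U))).
    rewrite <- comp_assoc, prdm_interchange, !comp_assoc.
    rewrite <- (comp_assoc (f ⊕₁ _)), N, comp_assoc.
    now rewrite prdm_interchange.
  - intros Z Z' f.
    assert (N : idm U ⊕₁ f ;; nR Z' = nR Z ;; idm U ⊗₁ f)
      by exact (iso_inv_nat (i := iR Z) (j := iR Z') (mx_nat (idm U) f)).
    rewrite <- comp_assoc, <- prdm_interchange, !comp_assoc.
    rewrite <- (comp_assoc (_ ⊕₁ f)), N, comp_assoc.
    now rewrite <- prdm_interchange.
  - intro Z. exact (proj1 (HL Z)).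
  - intro Z. exact (proj2 (HL Z)).
  - intro Z. exact (proj1 (HR Z)).
  - intro Z. exact (proj2 (HR Z)).
Qed.

Lemma splitting_swap (C : Category) (A B U : C) (u : A ~> B) (v : B ~> A)
  (r : A ~> U) (s : U ~> A) :
  binary_idempotent u v -> u ;; v = r ;; s -> s ;; r = idm U ->
  v ;; u = (v ;; r) ;; (s ;; u) /\ (s ;; u) ;; (v ;; r) = idm U.
Proof.
  intros [uvu vuv] e sr. split.
  - rewrite comp_assoc, <- (comp_assoc r), <- e, comp_assoc.
    now rewrite uvu.
  - rewrite comp_assoc, <- (comp_assoc u), e, comp_assoc, sr, comp_id_r.
    exact sr.
Qed.

Lemma coring_binary_splitting_in_core (X : MixCategory) (A B U : X)
  (u : A ~> B) (v : B ~> A) (r : A ~> U) (s : U ~> A) :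
  coring_binary_idempotent u v -> u ;; v = r ;; s -> s ;; r = idm U ->
  in_core U.
Proof.
  intros [bin [c | c]] e sr.
  - rewrite e in c. exact (coring_splitting_in_core sr c).
  - destruct (splitting_swap bin e sr) as [e' sr']. rewrite e' in c.
    exact (coring_splitting_in_core sr' c).
Qed.

(** * Dagger binary idempotents and preunitary structures *)

Lemma contramap_id (C D : Category) (F : Functor (op C) D) (A : C) :
  contramap F (idm A) = idm (F A).
Proof. exact (fmap_id F A). Qed.

Lemma contramap_comp (C D : Category) (F : Functor (op C) D) (A B E : C)
  (f : A ~> B) (g : B ~> E) :
  contramap F (f ;; g) = contramap F g ;; contramap F f.
Proof. exact (@fmap_comp _ _ F E B A g f). Qed.

Section Preunitary.

Variables (X : DaggerIsomix) (A U : X) (r : A ~> U) (s : U ~> A).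
Hypothesis sr : s ;; r = idm U.

Lemma dagger_splitting : r†₁ ;; s†₁ = idm U†.
Proof. now rewrite <- contramap_comp, sr, contramap_id. Qed.

Lemma preunitary_pullback_idempotent (phi : Iso U U†) :
  (r ;; phi ;; r†₁) ;; (s†₁ ;; inv phi ;; s) = r ;; s.
Proof.
  rewrite !comp_assoc, (comp_cancel_l _ dagger_splitting).
  now rewrite (comp_cancel_l _ (iso_mor_inv phi)).
Qed.

Lemma preunitary_pullback_binary (phi : Iso U U†) :
  binary_idempotent (r ;; phi ;; r†₁) (s†₁ ;; inv phi ;; s).
Proof.
  split.
  - rewrite <- comp_assoc, preunitary_pullback_idempotent.
    now rewrite comp_assoc, (comp_cancel_l _ sr).
  - rewrite preunitary_pullback_idempotent.
    now rewrite !comp_assoc, (comp_cancel_l _ sr).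
Qed.

Lemma preunitary_self_dagger (phi : Iso U U†) :
  phi ;; (inv phi)†₁ = ι U -> ι U ;; phi†₁ = phi.
Proof.
  intro E. rewrite <- E, comp_assoc, <- contramap_comp, iso_mor_inv.
  now rewrite contramap_id, comp_id_r.
Qed.

Lemma preunitary_pullback_dagger (phi : Iso U U†) :
  phi ;; (inv phi)†₁ = ι U ->
  dagger_binary_idempotent (r ;; phi ;; r†₁) (s†₁ ;; inv phi ;; s).
Proof.
  intro E. split; [apply preunitary_pullback_binary | split].
  - rewrite !contramap_comp, !comp_assoc, <- (comp_assoc (ι A)), <- iota_nat.
    rewrite comp_assoc, <- (comp_assoc (ι U)).
    now rewrite preunitary_self_dagger.
  - rewrite !contramap_comp, !comp_assoc, iota_nat, <- E, comp_assoc.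
    now rewrite (comp_cancel_l _ (iso_inv_mor phi)).
Qed.

Variables (u : A ~> A†) (v : A† ~> A).
Hypothesis uv_dag : dagger_binary_idempotent u v.
Hypothesis e : u ;; v = r ;; s.

(** The dagger conditions exchange the two composites:
    [(u ;; v)† = v† ;; u† = v ;; ι ;; u† = v ;; u]. *)
Lemma dagger_split_idempotent : s†₁ ;; r†₁ = v ;; u.
Proof.
  destruct uv_dag as (_ & Hu & Hv).
  now rewrite <- contramap_comp, <- e, contramap_comp, Hv, comp_assoc, <- Hu.
Qed.

Definition split_preunitary_iso : Iso U U†.
Proof.
  refine {| mor := s ;; u ;; s†₁; inv := r†₁ ;; v ;; r |};
    destruct uv_dag as ((uvu & vuv) & _).
  - rewrite !comp_assoc, <- (comp_assoc (s†₁)), dagger_split_idempotent.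
    rewrite <- (comp_assoc (v ;; u)), (comp_assoc v u v), vuv.
    rewrite <- (comp_assoc u), e.
    now rewrite comp_assoc, sr, comp_id_r.
  - rewrite !comp_assoc, <- (comp_assoc r), <- e.
    rewrite <- (comp_assoc (u ;; v)), (comp_assoc u v u), uvu.
    rewrite <- (comp_assoc v), <- dagger_split_idempotent, comp_assoc.
    rewrite (comp_cancel_l _ dagger_splitting). exact dagger_splitting.
Defined.

Lemma split_preunitary_iota :
  split_preunitary_iso ;; (inv split_preunitary_iso)†₁ = ι U.
Proof.
  destruct uv_dag as ((uvu & vuv) & Hu & Hv). cbn.
  rewrite !contramap_comp, !comp_assoc, <- (comp_assoc (s†₁)).
  rewrite dagger_split_idempotent.
  rewrite Hv, !comp_assoc, <- iota_nat.
  (* [u ;; v ;; u ;; v = r ;; s ;; r ;; s], which [s] and [r] absorb. *)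
  rewrite <- (comp_assoc u v), <- (comp_assoc u v (r ;; _)), e, !comp_assoc.
  now rewrite !(comp_cancel_l _ sr).
Qed.

End Preunitary.

Theorem theorem3p9 (X : DaggerIsomix) (A U : X) :
  canonical_compaction A U <->
  exists (u : A ~> A†) (v : A† ~> A),
    dagger_binary_idempotent u v /\
    coring_binary_idempotent u v /\
    splits_through (u ;; v) U.
Proof.
  split.
  - intros ([core phi Hphi] & r & s & sr). cbn in r, s, sr.
    exists (r ;; phi ;; r†₁), (s†₁ ;; inv phi ;; s).
    assert (E := preunitary_pullback_idempotent sr phi).
    split; [exact (preunitary_pullback_dagger sr Hphi) | split].
    + split; [exact (preunitary_pullback_binary sr phi) | left].
      rewrite E. exact (core_splitting_coring sr core).
    + exists r, s. now split.
  - intros (u & v & dag & cor & r & s & e & sr).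
    exists {| pu_core := coring_binary_splitting_in_core cor e sr;
              pu_iso := split_preunitary_iso sr dag e;
              pu_iota := split_preunitary_iota sr dag e |}.
    exists r, s. exact sr.
Qed.
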